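(* For every integer $n\ge2$, the Minkowski quotient of the bipermutahedron and the harmonic polytope is $\Pi_{n,n}/H_{n,n}=2$.
   Context: For polytopes $P,Q\subset\mathbb{R}^d$, the Minkowski quotient is $P/Q=\max\{\lambda\ge0:\ \lambda Q\text{ is a Minkowski summand of }P\}$, where $\lambda Q$ is a Minkowski summand of $P$ if $P=\lambda Q+R$ for some polytope $R$. The harmonic polytope is $H_{n,n}=\{(x,y)\in\mathbb{R}^n\times\mathbb{R}^n:\ \sum_ex_e=\sum_ey_e=\frac{n(n+1)}2+1,\ \sum_{s\in S}x_s+\sum_{t\in T}y_t\ge\frac{|S|(|S|+1)+|T|(|T|+1)}2+1\text{ for each bisubset }S|T\}$, where a bisubset of $[n]$ is an ordered pair $S|T$ of nonempty subsets with $S\cup T=[n]$, not both equal to $[n]$. The bipermutahedron: a bipermutation of $[n]$ is a sequence $\mathsf{B}=b_1|\cdots|b_{2n-1}$ of elements of $[n]$ in which one element $k$ appears exactly once and every other element exactly twice; form the length-$2n$ word replacing first and second occurrences of each $i\ne k$ by $i,\overline i$ and $k$ by $k\overline k$; let $\pi$ send the letters, left to right, to $-(2n-1),-(2n-3),\dots,-1,1,\dots,2n-1$; let $u=(x,y)$ with $x_i=\pi(i)$, $y_i=-\pi(\overline i)$, $s=\sum_ix_i$, and $v_{\mathsf{B}}=u-s(\mathsf{e}^k+\mathsf{f}^k)$ with $\mathsf{e}^k,\mathsf{f}^k$ the $k$-th standard basis vectors of the two factors. Then $\Pi_{n,n}=\mathrm{conv}\{v_{\mathsf{B}}:\mathsf{B}\text{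 a bipermutation of }[n]\}\subset\mathbb{R}^n\times\mathbb{R}^n$. *)

(* Defs.v *)
From HB Require Import structures.
From mathcomp Require Import all_boot all_order all_algebra.
From mathcomp Require Import all_classical all_reals all_analysis.

Set Implicit Arguments.
Unset Strict Implicit.
Unset Printing Implicit Defensive.

Import Order.TTheory GRing.Theory Num.Theory.

Local Open Scope classical_set_scope.
Local Open Scope ring_scope.

Definition convex_hull (R : realType) (V : lmodType R) (X : set V) : set V :=
  smallest (fun C : set V => convex_set (C : set (convex_lmodType V))) X.

Definition is_polytope (R : realType) (V : lmodType R) (P : set V) : Prop :=
  exists2 X : set V, finite_set X & P = convex_hull X.

Definition minkowski_sum (R : realType) (V : lmodType R) (A B : set V) :
  set V := [set a + b | a in A & b in B].

Definition dilate (R : realType) (V : lmodType R) (l : R) (A : set V) :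
  set V := [set l *: a | a in A].

Definition is_minkowski_summand (R : realType) (V : lmodType R)
    (Q P : set V) : Prop :=
  exists2 S : set V, is_polytope S & P = minkowski_sum Q S.

(* [q] is the maximum defining the Minkowski quotient [P / Q]; in particular
   the maximum is attained. *)
Definition is_minkowski_quotient (R : realType) (V : lmodType R)
    (P Q : set V) (q : R) : Prop :=
  let L := [set l : R | 0 <= l /\ is_minkowski_summand (dilate l Q) P] in
  L q /\ ubound L q.

Definition bisubset (n : nat) (S T : {set 'I_n}) : Prop :=
  [/\ S != finset.set0, T != finset.set0, S :|: T = [set: 'I_n]%SET
    & ~ (S = [set: 'I_n]%SET /\ T = [set: 'I_n]%SET)].

Definition harmonic_polytope (R : realType) (n : nat) :
    set ('rV[R]_n * 'rV[R]_n) :=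
  [set p : 'rV[R]_n * 'rV[R]_n |
     [/\ \sum_(e < n) p.1 ord0 e = (n * n.+1)%:R / 2 + 1,
         \sum_(e < n) p.2 ord0 e = (n * n.+1)%:R / 2 + 1
       & forall S T : {set 'I_n}, bisubset S T ->
           (#|S| * #|S|.+1 + #|T| * #|T|.+1)%:R / 2 + 1
             <= \sum_(s in S) p.1 ord0 s + \sum_(t in T) p.2 ord0 t]].
Arguments harmonic_polytope : clear implicits.

(* [k] is the element occurring exactly once. *)
Definition bipermutation (n : nat) (k : 'I_n)
    (B : (2 * n).-1.-tuple 'I_n) : Prop :=
  count_mem k B = 1%N /\ forall i : 'I_n, i != k -> count_mem i B = 2%N.

(* The letter [i] is encoded as [(i, false)] and the barred letter as
   [(i, true)]; [seen] lists the entries already read. *)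
Fixpoint bar_word_rec (n : nat) (k : 'I_n) (seen B : seq 'I_n) :
    seq ('I_n * bool) :=
  if B is b :: B' then
    (if b == k then [:: (k, false); (k, true)] else [:: (b, b \in seen)])
      ++ bar_word_rec k (b :: seen) B'
  else [::].

Definition bar_word (n : nat) (k : 'I_n) (B : seq 'I_n) :
    seq ('I_n * bool) := bar_word_rec k [::] B.

(* The letter in position [j = 0, ..., 2n - 1] has value [2j - (2n - 1)]. *)
Definition letter_value (R : realType) (n : nat) (k : 'I_n) (B : seq 'I_n)
    (c : 'I_n * bool) : R :=
  (2 * index c (bar_word k B))%:R - (2 * n)%:R + 1.

Definition biperm_u (R : realType) (n : nat) (k : 'I_n) (B : seq 'I_n) :
    'rV[R]_n * 'rV[R]_n :=
  (\row_i letter_value R k B (i, false),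
   \row_i - letter_value R k B (i, true)).

Definition biperm_vertex (R : realType) (n : nat) (k : 'I_n)
    (B : seq 'I_n) : 'rV[R]_n * 'rV[R]_n :=
  let u := biperm_u R k B in
  let s := \sum_i u.1 ord0 i in
  u - s *: (delta_mx ord0 k, delta_mx ord0 k).

Definition bipermutahedron (R : realType) (n : nat) :
    set ('rV[R]_n * 'rV[R]_n) :=
  convex_hull [set v | exists (k : 'I_n) (B : (2 * n).-1.-tuple 'I_n),
                         bipermutation k B /\ v = biperm_vertex R k B].
Arguments bipermutahedron : clear implicits.

(* Main.v *)
(* With max-convention support functions, and M = max_i (u_i + w_i), in the
   direction (u, w), writing D(z) = sum_(i,j) |z_i - z_j|:
     Pi_{n,n} : (D(u) + D(w)) / 2 + sum_(i,j) |u_i + w_j - M|,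
     H_{n,n}  : (D(u) + D(w)) / 4 + M + (a linear form).
   Up to a linear form, Pi - 2 H is thus sum_(i,j) |u_i + w_j - M| - 2 M.
   As u_i + w_j and u_j + w_i sum to at most 2 M, at most one of them exceeds
   M, so this equals (n - 2) M + 2 sum_(i<j) max(M, u_i + w_j, u_j + w_i), the
   support function of an explicit polytope R; hence Pi = 2 H + R,
   support functions being turned into sets by separation (Farkas).
   Conversely, along a direction crossing only a wall u_i = u_j (or only a wall
   u_1 + w_1 = u_2 + w_2 if n = 2), the kink of Pi is exactly twice that of H,
   so Pi - l H is not convex for l > 2. *)
From HB Require Import structures.
Require Import Defs.
From mathcomp Require Import all_boot all_order all_algebra.
From mathcomp Require Import all_classical all_reals all_analysis.
From mathcomp Require Import ring lra zify.

Set Implicit Arguments.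
Unset Strict Implicit.
Unset Printing Implicit Defensive.

Import Order.TTheory GRing.Theory Num.Theory.

Local Open Scope classical_set_scope.
Local Open Scope ring_scope.

(** * Convex hulls, Minkowski sums and Farkas' lemma *)

Section ConvexHull.
Variables (R : realType) (V : lmodType R).
Implicit Types (C X : set V) (x y : V).

Lemma convex_setE C : convex_set (C : set (convex_lmodType V)) <->
  forall x y (t : R), 0 <= t -> t <= 1 -> C x -> C y ->
    C (t *: x + (1 - t) *: y).
Proof.
split=> [cC x y t t0 t1 Cx Cy|cC x y t].
  by have /(_ x y (Itv01 t0 t1)) := cC; rewrite !inE; apply.
by rewrite !inE => Cx Cy; apply: cC.
Qed.

Lemma convex_hullW X : X `<=` convex_hull X.
Proof. exact: sub_gen_smallest. Qed.

Lemma convex_hull_min X C : convex_set (C : set (convex_lmodType V)) ->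
  X `<=` C -> convex_hull X `<=` C.
Proof. by move=> cC XC; exact: smallest_sub. Qed.

Lemma convex_hull_convex X :
  convex_set (convex_hull X : set (convex_lmodType V)).
Proof.
apply/convex_setE => x y t t0 t1 Hx Hy C [cC XC].
by move/convex_setE : (cC); apply => //; [exact: Hx|exact: Hy].
Qed.

Lemma convex_setD C X : convex_set (C : set (convex_lmodType V)) ->
  convex_set (X : set (convex_lmodType V)) ->
  convex_set (minkowski_sum C X : set (convex_lmodType V)).
Proof.
move=> /convex_setE cC /convex_setE cX.
apply/convex_setE => _ _ t t0 t1 [a Ca [b Xb <-]] [c Cc [d Xd <-]].
exists (t *: a + (1 - t) *: c); first exact: cC.
exists (t *: b + (1 - t) *: d); first exact: cX.
by rewrite !scalerDr addrACA.
Qed.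

Lemma convex_setZ (l : R) C : convex_set (C : set (convex_lmodType V)) ->
  convex_set (dilate l C : set (convex_lmodType V)).
Proof.
move=> /convex_setE cC.
apply/convex_setE => _ _ t t0 t1 [a Ca <-] [c Cc <-].
exists (t *: a + (1 - t) *: c); first exact: cC.
by rewrite scalerDr !scalerA ![l * _]mulrC.
Qed.

Lemma convex_set_sum C (x : nat -> V) m (l : nat -> R) :
    convex_set (C : set (convex_lmodType V)) ->
    (forall i, (i < m)%N -> C (x i)) -> (forall i, 0 <= l i) ->
  \sum_(i < m) l i = 1 -> C (\sum_(i < m) l i *: x i).
Proof.
move=> /convex_setE cC; elim: m l => [|m IH] l Cx l0.
  by rewrite big_ord0 => /esym/eqP; rewrite oner_eq0.
rewrite !big_ord_recr /= => sl.
have s0 : 0 <= \sum_(i < m) l i by apply: sumr_ge0.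
have [s1|sneq] := eqVneq (\sum_(i < m) l i) 0.
  have lm : l m = 1 by rewrite -sl s1 add0r.
  rewrite lm scale1r big1 ?add0r; first exact: Cx.
  move=> i _; suff -> : l i = 0 by rewrite scale0r.
  by apply/eqP; move/eqP: s1; rewrite psumr_eq0// => /allP/(_ i);
    rewrite mem_index_enum => /(_ isT).
set s := \sum_(i < m) l i in sl s0 sneq.
have -> : l m = 1 - s by lra.
have -> : \sum_(i < m) l i *: x i = s *: \sum_(i < m) (l i / s) *: x i.
  rewrite scaler_sumr; apply: eq_bigr => i _.
  by rewrite scalerA mulrCA divff// mulr1.
apply: cC => //.
- by rewrite -sl lerDl.
- apply: (IH (fun i => l i / s)) => [i im|i|].
  + by apply: Cx; rewrite ltnS ltnW.
  + by rewrite divr_ge0.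
  + by rewrite -mulr_suml divff.
- exact: Cx.
Qed.

End ConvexHull.

(* Bartl's proof: when the inductive solution [x1] violates only the last
   inequality, eliminate that functional by projecting along [x1]. *)
Lemma farkas (R : realFieldType) (V : lmodType R) (m : nat)
    (a : nat -> {scalar V}) (b : {scalar V}) :
  (exists2 l : nat -> R, (forall i, 0 <= l i) &
     forall x, b x = \sum_(i < m) l i * a i x) \/
  (exists2 x, forall i, (i < m)%N -> a i x <= 0 & 0 < b x).
Proof.
elim: m a b => [|m IH] a b.
  have [b0|nb0] := pselect (forall x, b x = 0).
    by left; exists (fun=> 0) => // x; rewrite b0 big_ord0.
  have bx : exists x, b x != 0.
    by apply: contrapT => nx; apply: nb0 => x; apply/eqP/negPn/negP => ?;
      apply: nx; exists x.
  right; case: bx => x /lt_total /orP[bx|bx]; last by exists x.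
  by exists (- x) => //; rewrite linearN oppr_gt0.
have [[l l0 lb]|[x1 ax1 bx1]] := IH a b.
  left; exists (fun i => if (i < m)%N then l i else 0) => [i|x].
    by case: ifP.
  rewrite big_ord_recr /= ltnn mul0r addr0 lb.
  by apply: eq_bigr => i _; rewrite ltn_ord.
have [am|am] := leP (a m x1) 0.
  right; exists x1 => // i; rewrite ltnS leq_eqVlt => /orP[/eqP->//|].
  exact: ax1.
pose c (f : {scalar V}) : R := f x1 / a m x1.
have lp (f : {scalar V}) : scalar (fun x => f x - c f * a m x).
  by move=> k x y /=; rewrite !linearP /=; ring.
pose pr (f : {scalar V}) : {scalar V} := HB.pack (fun x => f x - c f * a m x)
  (GRing.isLinear.Build _ _ _ _ _ (lp f)).
have [[l l0 lb]|[x ax bx]] := IH (pr \o a) (pr b).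
  (* The weight of [a m] is nonnegative because [b x1] and [a m x1] are positive while [a i x1 <= 0]
     for [i < m]. *)
  left; exists (fun i => if (i < m)%N then l i
                         else c b - \sum_(i < m) l i * c (a i)) => [i|x].
    case: ifP => // _; rewrite subr_ge0.
    apply: (@le_trans _ _ 0); last by rewrite divr_ge0// ltW.
    by apply: sumr_le0 => j _; rewrite mulr_ge0_le0// pmulr_lle0 ?invr_gt0 ?ax1.
  rewrite big_ord_recr /= ltnn.
  have /= := lb x => /eqP; rewrite subr_eq => /eqP ->.
  rewrite mulrBl addrCA addrC mulr_suml -sumrB; congr (_ + _).
  by apply: eq_bigr => i _ /=; rewrite ltn_ord; ring.
right; exists (x - (a m x / a m x1) *: x1) => [i|].
  rewrite linearB linearZ /= ltnS leq_eqVlt => /orP[/eqP ->|/ax /=].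
    by rewrite divfK ?subrr// gt_eqF.
  by apply: le_trans; rewrite /c le_eqVlt; apply/orP/or_introl/eqP; ring.
rewrite linearB linearZ /=; apply: lt_le_trans bx _.
by rewrite /= /c le_eqVlt; apply/orP/or_introl/eqP; ring.
Qed.

(** * The pairing of directions and points, and separation from a finite hull *)

Definition dotp (R : realType) (n : nat) (p q : 'rV[R]_n * 'rV[R]_n) : R :=
  \sum_i p.1 ord0 i * q.1 ord0 i + \sum_i p.2 ord0 i * q.2 ord0 i.

Section DotProduct.
Variables (R : realType) (n : nat).
Local Notation V := ('rV[R]_n * 'rV[R]_n)%type.
Implicit Types (p q : V).

Lemma dotpC p q : dotp p q = dotp q p.
Proof. by congr (_ + _); apply: eq_bigr => i _; rewrite mulrC. Qed.

Lemma dotp_linear p : scalar (dotp p).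
Proof.
move=> c q r; rewrite /dotp mulrDr !mulr_sumr addrACA -!big_split /=.
by apply: eq_bigr => i _; rewrite !mxE; ring.
Qed.

HB.instance Definition _ p :=
  GRing.isLinear.Build R V R _ (dotp p) (dotp_linear p).

Lemma dotp_delta1 i q : dotp (delta_mx ord0 i, 0) q = q.1 ord0 i.
Proof.
rewrite /dotp /= (bigD1 i)//= [X in _ + X + _]big1 => [|j /negPf ji].
  by rewrite [X in _ + X]big1 => [|j _]; rewrite !mxE ?eqxx ?mul0r//=; ring.
by rewrite mxE ji mul0r.
Qed.

Lemma dotp_delta2 i q : dotp (0, delta_mx ord0 i) q = q.2 ord0 i.
Proof.
rewrite /dotp /= addrC (bigD1 i)//= [X in _ + X + _]big1 => [|j /negPf ji].
  by rewrite [X in _ + X]big1 => [|j _]; rewrite !mxE ?eqxx ?mul0r//=; ring.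
by rewrite mxE ji mul0r.
Qed.

Lemma dotp_inj q r : (forall p, dotp p q = dotp p r) -> q = r.
Proof.
case: q r => [q1 q2] [r1 r2] qr; congr pair; apply/rowP => i.
  by have := qr (delta_mx ord0 i, 0); rewrite !dotp_delta1.
by have := qr (0, delta_mx ord0 i); rewrite !dotp_delta2.
Qed.

(** Farkas is applied after homogenising: a point [x] becomes the functional sending [(y, t)] to
    [dotp y x + t]. In the first alternative, evaluation at [(0, 1)] shows that the weights sum to
    1, and evaluation at [(p, 0)] that [q] is a convex combination. The second alternative gives
    [p]. *)
Lemma convex_hull_separation (X : set V) (q : V) : finite_set X ->
  ~ convex_hull X q -> exists p, forall x, X x -> dotp p x < dotp p q.
Proof.
move=> /finite_seqP[s ->{X}] nq.
have affl (x : V) : scalar (fun y : V * R^o => dotp y.1 x + y.2).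
  move=> c y z /=; rewrite dotpC linearP /= [dotp x _]dotpC [dotp x _]dotpC.
  by rewrite /GRing.scale /=; ring.
pose aff (x : V) : {scalar (V * R^o)%type} :=
  HB.pack (fun y : V * R^o => dotp y.1 x + y.2)
    (GRing.isLinear.Build _ _ _ _ _ (affl x)).
have [[l l0 lq]|[[p t] pt qt]] :=
    farkas (size s) (fun i => aff (nth 0 s i)) (aff q).
  case: nq; have sl : \sum_(i < size s) l i = 1.
    have /= := lq (0, 1); rewrite dotpC linear0 add0r => ->.
    by apply: eq_bigr => i _; rewrite dotpC linear0 add0r mulr1.
  suff -> : q = \sum_(i < size s) l i *: nth 0 s i.
    apply: convex_set_sum => //; first exact: convex_hull_convex.
    by move=> i si; apply: convex_hullW; rewrite /= mem_nth.
  apply: dotp_inj => p; have /= := lq (p, 0); rewrite addr0 => ->.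
  by rewrite linear_sum; apply: eq_bigr => i _; rewrite linearZ /= addr0.
exists p => x /= xs; rewrite -(ltrD2r t); apply: le_lt_trans qt => /=.
by have /= := pt (index x s); rewrite index_mem nth_index//; apply.
Qed.

Lemma dotp_hull_le (X : set V) p c : (forall x, X x -> dotp p x <= c) ->
  forall x, convex_hull X x -> dotp p x <= c.
Proof.
move=> Xc; apply: convex_hull_min => //; apply/convex_setE => x y t t0 t1 xc yc.
rewrite /= linearD !linearZ /= /GRing.scale /=.
have -> : c = t * c + (1 - t) * c by ring.
by rewrite lerD// ler_wpM2l// subr_ge0.
Qed.

End DotProduct.

(** * Pairwise differences and threshold decompositions *)

(** Ordered pairs are summed, so [dif z / 4] is the support function of the permutohedron of
    [1, ..., n] centred at the origin. *)
Definition dif (R : realType) (I : finType) (z : I -> R) : R :=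
  \sum_i \sum_j `|z i - z j|.

(** Repeated values are harmless: for [l < k] the test [t l < t k] fails only when the increment at
    [l] is zero. *)
Lemma telescope_threshold (R : realType) (t : nat -> R) (m k : nat) :
    (forall l, t l <= t l.+1) -> (k <= m)%N ->
  \sum_(l < m) (t l.+1 - t l) * (t l < t k)%R%:R = t k - t 0.
Proof.
move=> tS; have tm : {homo t : i j / (i <= j)%N >-> i <= j}.
  by apply: homo_leq => // y x z; exact: le_trans.
elim: m => [|m IH]; first by rewrite leqn0 => /eqP->; rewrite big_ord0 subrr.
rewrite leq_eqVlt => /orP[/eqP->|km]; last first.
  by rewrite big_ord_recr /= IH// ltNge tm// mulr0 addr0.
rewrite -(telescope_sumr _ (leq0n _)) big_mkord; apply: eq_bigr => l _.
have := tS l; rewrite le_eqVlt => /orP[/eqP->|tl]; first by rewrite subrr mul0r.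
by rewrite (lt_le_trans tl) ?mulr1// tm.
Qed.

Lemma thresholds (R : realType) (J : finType) (z : J -> R) :
  exists (m : nat) (t : nat -> R), (forall l, t l <= t l.+1) /\
    forall j, exists2 k, (k <= m)%N & z j = t k.
Proof.
pose s := sort <=%R [seq z j | j <- enum J].
(* Clamping the index keeps the sequence nondecreasing past the end of [s], where [nth] would return
   its default 0. *)
exists (size s), (fun l => nth 0 s (minn l (size s).-1)); split=> [l|j].
  have [->|s0] := eqVneq s [::]; first by rewrite !nth_nil.
  have ss : (0 < size s)%N by case: s s0.
  have := sort_le_sorted [seq z j | j <- enum J].
  rewrite -/s => /(sorted_leq_nth le_trans le_refl 0); apply.
  - by rewrite inE -[X in (_ < X)%N](prednK ss) ltnS geq_minr.
  - by rewrite inE -[X in (_ < X)%N](prednK ss) ltnS geq_minr.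
  - by rewrite leq_min geq_minr andbT (leq_trans (geq_minl _ _)).
have zs : z j \in s by rewrite mem_sort map_f// mem_enum.
exists (index (z j) s); first by rewrite index_size.
have js : (index (z j) s < size s)%N by rewrite index_mem.
have /minn_idPl-> : (index (z j) s <= (size s).-1)%N by lia.
by rewrite nth_index.
Qed.

(** * The slack inequality for points of the harmonic polytope *)

Section HarmonicSupport.
Variables (R : realType) (n : nat).
Implicit Types (x y a b : 'I_n -> R).

(** The support function of the permutohedron of [1, ..., n] at [a], minus the pairing of [x] with
    [a]. *)
Definition slack x a : R :=
  n.+1%:R / 2 * \sum_i a i + dif a / 4 - \sum_i x i * a i.

(** The layers are all ordered like [a], so no cancellation occurs in [|a i - a j|] and [dif] is
    additive on them. The other terms are linear, and [dif] does not see the constant [c]. *)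
Lemma slack_layers x a (m : nat) (d : nat -> R) (A : nat -> 'I_n -> R) c :
    (forall l, 0 <= d l) ->
    (forall l i j, a i <= a j -> A l i <= A l j) ->
    (forall i, a i = c + \sum_(l < m) d l * A l i) ->
  slack x a = (n.+1%:R * n%:R / 2 - \sum_i x i) * c
              + \sum_(l < m) d l * slack x (A l).
Proof.
move=> d0 mA aE.
have sE : \sum_i a i = n%:R * c + \sum_(l < m) d l * \sum_i A l i.
  under eq_bigr do rewrite aE.
  rewrite big_split /= sumr_const card_ord -[c *+ n]mulr_natl; congr (_ + _).
  by rewrite exchange_big; apply: eq_bigr => l _; rewrite mulr_sumr.
have xE : \sum_i x i * a i = (\sum_i x i) * c
    + \sum_(l < m) d l * \sum_i x i * A l i.
  under eq_bigr do rewrite aE mulrDr mulr_sumr.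
  rewrite big_split /= -mulr_suml; congr (_ + _).
  rewrite exchange_big; apply: eq_bigr => l _; rewrite mulr_sumr.
  by apply: eq_bigr => i _; rewrite mulrCA.
have ad i j : a i - a j = \sum_(l < m) d l * (A l i - A l j).
  rewrite !aE opprD addrACA subrr add0r -sumrB.
  by apply: eq_bigr => l _; rewrite mulrBr.
have dE : dif a = \sum_(l < m) d l * dif (A l).
  rewrite /dif; under [RHS]eq_bigr do rewrite mulr_sumr.
  rewrite [RHS]exchange_big; apply: eq_bigr => i _ /=.
  under [RHS]eq_bigr do rewrite mulr_sumr.
  rewrite [RHS]exchange_big; apply: eq_bigr => j _ /=.
  have [aij|/ltW aij] := leP (a i) (a j).
    rewrite distrC ger0_norm ?subr_ge0// ad; apply: eq_bigr => l _.
    by rewrite distrC ger0_norm// subr_ge0 mA.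
  rewrite ger0_norm ?subr_ge0// ad; apply: eq_bigr => l _.
  by rewrite ger0_norm// subr_ge0 mA.
have -> : \sum_(l < m) d l * slack x (A l) =
    n.+1%:R / 2 * (\sum_(l < m) d l * \sum_i A l i)
    + (\sum_(l < m) d l * dif (A l)) / 4
    - \sum_(l < m) d l * \sum_i x i * A l i.
  rewrite mulr_sumr mulr_suml -big_split -sumrB.
  by apply: eq_bigr => l _; rewrite /slack /=; ring.
by rewrite /slack sE xE dE; ring.
Qed.

Lemma dif_indicator (A : {set 'I_n}) :
  dif (fun i => (i \in A)%:R : R) = 2 * #|A|%:R * (n%:R - #|A|%:R).
Proof.
have cA : n%:R = #|A|%:R + #|~: A|%:R :> R.
  by rewrite -natrD cardsC card_ord.
rewrite /dif (bigID (mem A)) /=.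
rewrite (eq_bigr (fun=> #|~: A|%:R)) => [|i iA]; last first.
  rewrite (bigID (mem A)) /= iA big1 => [|j ->]; last by rewrite subrr normr0.
  rewrite add0r (eq_bigr (fun=> 1)) => [|j /negPf->]; last first.
    by rewrite subr0 normr1.
  rewrite sumr_const; congr (_ *+ _); apply: eq_card => j.
  by rewrite !inE.
rewrite [X in _ + X](eq_bigr (fun=> #|A|%:R)) => [|i /negPf iA]; last first.
  rewrite (bigID (mem A)) /= iA addrC big1 => [|j /negPf->]; last first.
    by rewrite subrr normr0.
  rewrite add0r (eq_bigr (fun=> 1)) => [|j ->]; last by rewrite sub0r normrN1.
  by rewrite sumr_const.
rewrite !sumr_const.
have -> : #|[pred i | i \notin A]| = #|~: A|.
  by apply: eq_card => j; rewrite !inE.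
rewrite -[_ *+ #|A|]mulr_natr -[_ *+ #|~: A|]mulr_natr cA.
by ring.
Qed.

(** The first term is the sum of the [#|A|] largest numbers among [1, ..., n]. *)
Lemma slack_indicator x (A : {set 'I_n}) :
  slack x (fun i => (i \in A)%:R) =
  (#|A|%:R * (2 * n%:R + 1 - #|A|%:R)) / 2 - \sum_(i in A) x i.
Proof.
rewrite /slack dif_indicator.
have -> : \sum_i x i * (i \in A)%:R = \sum_(i in A) x i.
  by rewrite [RHS]big_mkcond; apply: eq_bigr => i _;
    case: ifP; rewrite ?mulr1 ?mulr0.
have -> : \sum_i (i \in A)%:R = #|A|%:R :> R.
  rewrite -[RHS]sumr_const [RHS]big_mkcond; apply: eq_bigr => i _.
  by case: ifP.
by rewrite -[n.+1%:R]natr1; field.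
Qed.

(** The coordinate sums turn this into the inequality for the bisubset of complements, which cover
    since [A] and [B] are disjoint. The complements fail to be a bisubset only if [A] or [B] is
    everything or both are empty; the slack is then -1, -1 or 0. *)
Lemma slack_disjoint (h : 'rV[R]_n * 'rV[R]_n) (A B : {set 'I_n}) :
    harmonic_polytope R n h -> A :&: B = finset.set0 ->
  -1 <= slack (h.1 ord0) (fun i => (i \in A)%:R)
        + slack (h.2 ord0) (fun i => (i \in B)%:R).
Proof.
move=> [hx hy hST] dAB; rewrite !slack_indicator.
have cC (C : {set 'I_n}) : #|~: C|%:R = n%:R - #|C|%:R :> R.
  by apply/eqP; rewrite eq_sym subr_eq -natrD addnC cardsC card_ord.
have xC (x : 'rV[R]_n) (C : {set 'I_n}) :
    \sum_(i in ~: C) x ord0 i = \sum_i x ord0 i - \sum_(i in C) x ord0 i.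
  rewrite [X in X - _](bigID (mem C)) /= addrC addrK.
  by apply: eq_bigl => i; rewrite inE.
have xT (x : 'rV[R]_n) :
    \sum_(i in [set: 'I_n]%SET) x ord0 i = \sum_i x ord0 i.
  by apply: eq_bigl => i; rewrite finset.inE.
have nE : (n * n.+1)%:R = n%:R * (n%:R + 1) :> R by rewrite natrM natr1.
have [AT|AT] := eqVneq A [set: 'I_n]%SET.
  have -> : B = finset.set0.
    by rewrite -dAB AT finset.setTI.
  rewrite AT cards0 big_set0 cardsT card_ord.
  by rewrite xT hx nE; lra.
have [BT|BT] := eqVneq B [set: 'I_n]%SET.
  have -> : A = finset.set0.
    by rewrite -dAB BT finset.setIT.
  rewrite BT cards0 big_set0 cardsT card_ord.
  by rewrite xT hy nE; lra.
have [/andP[/eqP-> /eqP->]|AB0] :=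
    boolP ((A == finset.set0) && (B == finset.set0)).
  by rewrite !cards0 !big_set0; lra.
have /hST : bisubset (~: A) (~: B).
  split.
  - by apply: contra_neq AT => A0; rewrite -[A]finset.setCK A0 finset.setC0.
  - by apply: contra_neq BT => B0; rewrite -[B]finset.setCK B0 finset.setC0.
  - by rewrite -finset.setCI dAB finset.setC0.
  - case=> AC BC; move: AB0.
    by rewrite -[A]finset.setCK AC -[B]finset.setCK BC finset.setCT eqxx.
rewrite !xC hx hy nE natrD !natrM -!natr1 !cC.
by lra.
Qed.

(* Layer cake: cutting at the values of [a] and [- b], the superlevel sets
   [t < a] and [- b <= t] are disjoint because [a <= - b], so the slack is a
   nonnegative combination of the slacks of bisubset inequalities (up to
   complement), each at least [-1], plus the length of the cutting range. *)
Lemma harmonic_slack_ge0 (h : 'rV[R]_n * 'rV[R]_n) a b :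
    harmonic_polytope R n h -> (forall i, a i + b i <= 0) ->
  0 <= slack (h.1 ord0) a + slack (h.2 ord0) b.
Proof.
move=> Hh ab0; have [hx hy _] := Hh.
pose z (j : 'I_n * bool) := if j.2 then - b j.1 else a j.1.
have [m [t [tS tz]]] := thresholds z.
pose d l := t l.+1 - t l.
pose A l := [set i | t l < a i]%SET.
pose B l := [set i | - b i <= t l]%SET.
have d0 l : 0 <= d l by rewrite subr_ge0.
have sd : \sum_(l < m) d l = t m - t 0.
  by rewrite -(telescope_sumr _ (leq0n _)) big_mkord.
rewrite (@slack_layers _ a m d (fun l i => (i \in A l)%:R) (t 0))//.
(* Both coordinate sums exceed n(n+1)/2 by 1, so the base values [t 0] and [- t m] enter with
   coefficient -1 and contribute [t m - t 0]. *)
- rewrite (@slack_layers _ b m d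
      (fun l i => (i \in B l)%:R) (- t m))//.
  + rewrite hx hy natrM mulrC.
    have : \sum_(l < m) d l * -1 <= \sum_(l < m) (d l *
        (slack (h.1 ord0) (fun i => (i \in A l)%:R)
        + slack (h.2 ord0) (fun i => (i \in B l)%:R))).
      apply: ler_sum => l _; rewrite ler_wpM2l//; apply: slack_disjoint => //.
      apply/setP => i; rewrite /A /B !inE.
      by apply/negP => /andP[]; have := ab0 i; lra.
    under [X in _ <= X]eq_bigr do rewrite mulrDr.
    rewrite big_split /= -mulr_suml sd; lra.
  + move=> l i j bij; rewrite ler_nat /A /B !inE.
    by case: leP => // ?; have -> : - b j <= t l by lra.
  + move=> i; have [k km] := tz (i, true); rewrite /z /= => bk.
    have := telescope_threshold tS km; rewrite -bk => tk.
    rewrite (eq_bigr (fun l : 'I_m => d l - d l * (t l < - b i)%R%:R)).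
      by rewrite sumrB sd tk; ring.
    move=> l _; rewrite /A /B inE leNgt.
    by case: (_ < _); rewrite ?mulr0 ?mulr1 ?subrr ?subr0.
- move=> l i j aij; rewrite ler_nat /A /B !inE.
  by case: ltP => // ?; have -> : t l < a j by lra.
- move=> i; have [k km] := tz (i, false); rewrite /z /= => ak.
  have := telescope_threshold tS km; rewrite -ak => tk.
  rewrite (eq_bigr (fun l : 'I_m => d l * (t l < a i)%R%:R)).
    by rewrite tk; ring.
  by move=> l _; rewrite /A /B inE.
Qed.

End HarmonicSupport.

(** Averaging with the swap of [i] and [j] turns a pairing with sums of pairwise signs into a sum
    over differences, to be compared with [dif]. *)
Lemma sum_antisym (R : realType) (I : finType) (z : I -> R) (e : I -> I -> R) :
  (forall i j, e i j = - e j i) ->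
  \sum_i z i * \sum_j e i j = (\sum_i \sum_j (z i - z j) * e i j) / 2.
Proof.
move=> eN; have -> : \sum_i \sum_j (z i - z j) * e i j =
    \sum_i \sum_j z i * e i j - \sum_i \sum_j z j * e i j.
  rewrite -sumrB; apply: eq_bigr => i _; rewrite -sumrB.
  by apply: eq_bigr => j _; rewrite mulrBl.
rewrite [X in _ - X]exchange_big -sumrN /=.
rewrite -big_split mulr_suml; apply: eq_bigr => i _ /=.
rewrite mulr_sumr -sumrN -big_split mulr_suml; apply: eq_bigr => j _ /=.
by rewrite [e j i]eN; field.
Qed.

(** * Support functions of the harmonic polytope and of the residual summand *)

Section SupportFunctions.
Variables (R : realType) (n : nat).
Local Notation V := ('rV[R]_n * 'rV[R]_n)%type.
Implicit Types (p h : V) (M : R) (b c : 'M[bool]_n) (k : 'I_n).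

Definition cross p M : R :=
  \sum_i \sum_j `|p.1 ord0 i + p.2 ord0 j - M|.

Definition coord_sum p : R := \sum_i p.1 ord0 i + \sum_i p.2 ord0 i.

(** [M] is kept free: any bound on the diagonal sums [p.1 i + p.2 i] gives an upper bound, and the
    largest diagonal sum gives the support function. *)
Definition harmonic_support p M : R :=
  n.+1%:R / 2 * coord_sum p + (dif (p.1 ord0) + dif (p.2 ord0)) / 4 + M.

Definition biperm_support p M : R :=
  (dif (p.1 ord0) + dif (p.2 ord0)) / 2 + cross p M.

Definition residual_support p M : R :=
  cross p M - 2 * M - n.+1%:R * coord_sum p.

Lemma biperm_support_split p M :
  biperm_support p M = 2 * harmonic_support p M + residual_support p M.
Proof.
by rewrite /biperm_support /harmonic_support /residual_support; field.
Qed.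

(** Subtracting [M] from the first component makes the diagonal sums nonpositive. [dif] is
    unchanged, and the linear terms change by exactly [M], since the first coordinate sum of [h] is
    n(n+1)/2 + 1. *)
Lemma harmonic_support_ge p M h : harmonic_polytope R n h ->
  (forall i, p.1 ord0 i + p.2 ord0 i <= M) -> dotp p h <= harmonic_support p M.
Proof.
move=> Hh pM; have [hx hy _] := Hh.
have /(harmonic_slack_ge0 Hh) :
    forall i, (p.1 ord0 i - M) + p.2 ord0 i <= 0 by move=> i; have := pM i; lra.
have dM : dif (fun i => p.1 ord0 i - M) = dif (p.1 ord0).
  by apply: eq_bigr => i _; apply: eq_bigr => j _; congr `|_|; ring.
have xM : \sum_i h.1 ord0 i * (p.1 ord0 i - M) =
    \sum_i p.1 ord0 i * h.1 ord0 i - M * \sum_i h.1 ord0 i.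
  rewrite mulr_sumr -sumrB; apply: eq_bigr => i _; ring.
rewrite /slack dM xM hx sumrB sumr_const card_ord -[M *+ n]mulr_natl natrM.
rewrite /harmonic_support /coord_sum /dotp.
rewrite [X in _ <= _ + (_ - X)](eq_bigr (fun i => p.2 ord0 i * h.2 ord0 i)).
  by lra.
by move=> i _; rewrite mulrC.
Qed.

(* An arbitrary boolean matrix replaces the order of a permutation: these are
   points of the permutohedron (as a zonotope), including all its vertices. *)
Definition permutohedron_coord b i : R :=
  n.+1%:R / 2 + (\sum_j ((b i j)%:R - (b j i)%:R)) / 2.

(** Terms with both indices in [S] cancel; each of the remaining ones, from [S] to its complement,
    is at least -1. *)
Lemma permutohedron_coord_sum b (S : {set 'I_n}) :
  #|S|%:R * (#|S|%:R + 1) / 2 <= \sum_(i in S) permutohedron_coord b i.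
Proof.
rewrite big_split /= sumr_const -mulr_suml -[n.+1%:R / 2 *+ _]mulr_natl.
have -> : \sum_(i in S) \sum_j ((b i j)%:R - (b j i)%:R) =
    \sum_(i in S) \sum_(j in ~: S) ((b i j)%:R - (b j i)%:R) :> R.
  apply/eqP; rewrite -subr_eq0 -sumrB; apply/eqP.
  transitivity (\sum_(i in S) \sum_(j in S) ((b i j)%:R - (b j i)%:R) : R).
    apply: eq_bigr => i _; rewrite (bigID (mem S)) /=.
    rewrite [X in _ + X - _](eq_bigl (mem (~: S))) ?addrK// => j.
    by rewrite /= inE.
  under eq_bigr do rewrite sumrB.
  by rewrite sumrB [X in _ - X]exchange_big subrr.
have : - (#|S|%:R * #|~: S|%:R) <=
    \sum_(i in S) \sum_(j in ~: S) ((b i j)%:R - (b j i)%:R) :> R.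
  rewrite -mulrN -sumr_const mulr_suml; apply: ler_sum => i _.
  rewrite mul1r -sumr_const -sumrN; apply: ler_sum => j _.
  by case: (b i j); case: (b j i); rewrite /=; lra.
have -> : #|~: S|%:R = n%:R - #|S|%:R :> R.
  by apply/eqP; rewrite eq_sym subr_eq -natrD addnC cardsC card_ord.
by rewrite -[n.+1%:R]natr1; lra.
Qed.

Lemma permutohedron_coord_total b :
  \sum_i permutohedron_coord b i = (n * n.+1)%:R / 2.
Proof.
rewrite big_split /= sumr_const card_ord -mulr_suml.
under [X in _ + X / _]eq_bigr do rewrite sumrB.
rewrite sumrB [X in _ + (_ - X) / _]exchange_big subrr mul0r addr0.
by rewrite -[n.+1%:R / 2 *+ _]mulr_natl natrM mulrA.
Qed.

Lemma permutohedron_coord_dot (z : 'I_n -> R) :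
  \sum_i z i * permutohedron_coord (\matrix_(i, j) (z j < z i)) i =
  n.+1%:R / 2 * \sum_i z i + dif z / 4.
Proof.
set b := \matrix_(i, j) _.
have -> : \sum_i z i * permutohedron_coord b i = n.+1%:R / 2 * \sum_i z i
    + (\sum_i z i * \sum_j ((b i j)%:R - (b j i)%:R)) / 2.
  rewrite mulr_sumr mulr_suml -big_split; apply: eq_bigr => i _ /=.
  by rewrite /permutohedron_coord; ring.
rewrite sum_antisym => [|i j]; last by rewrite opprB.
have -> : dif z / 4 = dif z / 2 / 2 by field.
congr (_ + _ / 2 / 2).
apply: eq_bigr => i _; apply: eq_bigr => j _; rewrite !mxE.
case: (ltgtP (z i) (z j)) => [zij|zij|->]; rewrite ?subrr ?mulr0 ?normr0//.
  by rewrite ltr0_norm ?subr_lt0//= mulrBr; ring.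
by rewrite gtr0_norm ?subr_gt0//= mulrBr; ring.
Qed.

(** A point of the product of two permutohedra, translated by a vertex [e_k + f_k] of a simplex; the
    simplex accounts for the term [M]. *)
Definition harmonic_point (t : 'I_n * 'M[bool]_n * 'M[bool]_n) : V :=
  (\row_i (permutohedron_coord t.1.2 i + (i == t.1.1)%:R),
   \row_i (permutohedron_coord t.2 i + (i == t.1.1)%:R)).

Lemma sum_delta k (S : {set 'I_n}) :
  \sum_(i in S) (i == k)%:R = (k \in S)%:R :> R.
Proof.
have [kS|kS] := boolP (k \in S).
  by rewrite (bigD1 k)//= eqxx big1 ?addr0// => i /andP[_ /negPf->].
by rewrite big1// => i iS; case: eqP => // ik; rewrite -ik iS in kS.
Qed.

Lemma sum_delta_dot k (z : 'I_n -> R) : \sum_i z i * (i == k)%:R = z k.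
Proof.
rewrite (bigD1 k)//= eqxx mulr1 big1 ?addr0// => i /negPf->.
by rewrite mulr0.
Qed.

Lemma harmonic_point_in t : harmonic_polytope R n (harmonic_point t).
Proof.
case: t => [[k b] c]; rewrite /harmonic_point /=.
split => [||S T [S0 T0 ST _]] /=.
- under eq_bigr do rewrite mxE.
  rewrite big_split /= permutohedron_coord_total; congr (_ + _).
  by rewrite -[RHS](sum_delta_dot k (fun=> 1)); apply: eq_bigr => i _;
    rewrite mul1r.
- under eq_bigr do rewrite mxE.
  rewrite big_split /= permutohedron_coord_total; congr (_ + _).
  by rewrite -[RHS](sum_delta_dot k (fun=> 1)); apply: eq_bigr => i _;
    rewrite mul1r.
under eq_bigr do rewrite mxE.
under [X in _ <= _ + X]eq_bigr do rewrite mxE.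
have splitE d (U : {set 'I_n}) :
    \sum_(i in U) (permutohedron_coord d i + (i == k)%:R) =
    \sum_(i in U) permutohedron_coord d i + (k \in U)%:R.
  by rewrite big_split sum_delta.
rewrite !splitE.
have := permutohedron_coord_sum b S; have := permutohedron_coord_sum c T.
(* As [S] and [T] cover, the translation by [e_k + f_k] supplies the extra 1 in the bisubset
   inequality. *)
have : 1 <= (k \in S)%:R + (k \in T)%:R :> R.
  have : k \in S :|: T by rewrite ST inE.
  by rewrite inE; case: (k \in S); case: (k \in T);
    rewrite //= ?addr0 ?add0r// lerDl.
by rewrite natrD !natrM -!natr1; lra.
Qed.

Lemma harmonic_support_attained p k :
  exists t, dotp p (harmonic_point t) =
            harmonic_support p (p.1 ord0 k + p.2 ord0 k).
Proof.
exists (k, \matrix_(i, j) (p.1 ord0 j < p.1 ord0 i),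
           \matrix_(i, j) (p.2 ord0 j < p.2 ord0 i)).
rewrite /dotp /=; under eq_bigr do rewrite mxE mulrDr.
under [X in _ + X]eq_bigr do rewrite mxE mulrDr.
rewrite !big_split /= !permutohedron_coord_dot !sum_delta_dot.
by rewrite /harmonic_support /coord_sum; field.
Qed.

(** The case [i = j] excludes diagonal entries. The pairs whose sum [p.1 i + p.2 j] exceeds a bound
    on all diagonal sums form such a matrix. *)
Definition admissible b := forall i j, ~~ (b i j && b j i).

Definition residual_coeff b : R :=
  n%:R ^+ 2 - 2 - 2 * \sum_i \sum_j (b i j)%:R.

(* For each [b i j] the pair [e_i + f_j] replaces one of the [e_k + f_k]; by
   admissibility at most [n (n - 1) / 2] of the [n ^ 2 - 2] are replaced, twice
   each, which is where [2 <= n] enters. *)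
Definition residual_point (t : 'I_n * 'M[bool]_n) : V :=
  (\row_i (residual_coeff t.2 * (i == t.1)%:R
           + 2 * \sum_j (t.2 i j)%:R - (2 * n%:R + 1)),
   \row_j (residual_coeff t.2 * (j == t.1)%:R
           + 2 * \sum_i (t.2 i j)%:R - (2 * n%:R + 1))).

Lemma residual_coeff_ge0 b : (2 <= n)%N -> admissible b ->
  0 <= residual_coeff b.
Proof.
move=> n2 ab; have : 2 * \sum_i \sum_j (b i j)%:R <= n%:R ^+ 2 - n%:R :> R.
  (* The double sum is added to its transpose: position [(i, j)] then holds at most 1 off the
     diagonal and 0 on it. *)
  rewrite mulr2n mulrDl mul1r [X in X + _]exchange_big -big_split /=.
  have -> : n%:R ^+ 2 - n%:R = \sum_(i < n) \sum_(j < n) (1 - (j == i)%:R) :> R.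
    rewrite (eq_bigr (fun=> n%:R - 1)) => [|i _].
      by rewrite sumr_const card_ord -[(n%:R - 1) *+ n]mulr_natl; ring.
    rewrite sumrB sumr_const card_ord; congr (_ - _).
    by rewrite (bigD1 i)//= eqxx big1 ?addr0// => j /negPf->.
  apply: ler_sum => i _; rewrite -big_split; apply: ler_sum => j _ /=.
  have := ab i j; have := ab j i.
  have [->|_] := eqVneq j i.
    by rewrite andbb; case: (b i i) => //= _ _; lra.
  by case: (b i j); case: (b j i) => //= _ _; lra.
have : 2 <= n%:R :> R by rewrite (ler_nat R 2).
by rewrite /residual_coeff; lra.
Qed.

Lemma residual_point_dot p k b : dotp p (residual_point (k, b)) =
  residual_coeff b * (p.1 ord0 k + p.2 ord0 k)
  + 2 * (\sum_i \sum_j (b i j)%:R * (p.1 ord0 i + p.2 ord0 j))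
  - (2 * n%:R + 1) * coord_sum p.
Proof.
have expand (z : 'I_n -> R) (f : 'I_n -> R) : \sum_i z i *
    (residual_coeff b * (i == k)%:R + 2 * f i - (2 * n%:R + 1)) =
    residual_coeff b * z k + 2 * (\sum_i z i * f i)
    - (2 * n%:R + 1) * \sum_i z i.
  rewrite -[z k](sum_delta_dot k) !mulr_sumr -big_split -sumrB /=.
  by apply: eq_bigr => i _; ring.
rewrite /dotp /=; under eq_bigr do rewrite mxE.
under [X in _ + X]eq_bigr do rewrite mxE.
rewrite !expand /coord_sum.
have -> : \sum_i \sum_j (b i j)%:R * (p.1 ord0 i + p.2 ord0 j) =
    \sum_i p.1 ord0 i * \sum_j (b i j)%:R
    + \sum_j p.2 ord0 j * \sum_i (b i j)%:R.
  under [X in _ = _ + X]eq_bigr do rewrite mulr_sumr.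
  rewrite [X in _ = _ + X]exchange_big -big_split; apply: eq_bigr => i _ /=.
  rewrite mulr_sumr -big_split; apply: eq_bigr => j _ /=; ring.
by ring.
Qed.

Lemma cross_sum p M :
  \sum_i \sum_j (p.1 ord0 i + p.2 ord0 j - M) =
  n%:R * coord_sum p - n%:R ^+ 2 * M.
Proof.
under eq_bigr do rewrite sumrB big_split /= !sumr_const card_ord.
rewrite sumrB big_split /= !sumr_const card_ord /coord_sum.
rewrite sumrMnl -[(\sum_i p.1 ord0 i) *+ n]mulr_natr.
rewrite -[(\sum_i p.2 ord0 i) *+ n]mulr_natr -mulrnA -[M *+ _]mulr_natr natrM.
by ring.
Qed.

(** Each bit satisfies [2 b a <= |a| + a], which is summed over all pairs with
    [a = p.1 i + p.2 j - M]. The coefficient 2n+1 in [residual_point] collects n from [cross_sum]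
    and n+1 from [residual_support]. *)
Lemma residual_support_ge p M t : (2 <= n)%N -> admissible t.2 ->
  (forall i, p.1 ord0 i + p.2 ord0 i <= M) ->
  dotp p (residual_point t) <= residual_support p M.
Proof.
case: t => k b /= n2 ab pM; rewrite residual_point_dot.
have c0 := residual_coeff_ge0 n2 ab.
have := ler_wpM2l c0 (pM k).
have : \sum_i \sum_j (b i j)%:R * 2 * (p.1 ord0 i + p.2 ord0 j - M) <=
    cross p M + (n%:R * coord_sum p - n%:R ^+ 2 * M).
  rewrite -cross_sum /cross -big_split; apply: ler_sum => i _.
  rewrite -big_split; apply: ler_sum => j _ /=.
  set a := _ - M; have := ler_norm a; have := ler_norm (- a); rewrite normrN.
  by case: (b i j); rewrite /= ?mul0r ?mul1r; lra.
have -> : \sum_i \sum_j (b i j)%:R * 2 * (p.1 ord0 i + p.2 ord0 j - M) =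
    2 * (\sum_i \sum_j (b i j)%:R * (p.1 ord0 i + p.2 ord0 j))
    - 2 * M * \sum_i \sum_j (b i j)%:R.
  rewrite !mulr_sumr -sumrB; apply: eq_bigr => i _.
  rewrite !mulr_sumr -sumrB; apply: eq_bigr => j _; ring.
rewrite /residual_support /residual_coeff -[n.+1%:R]natr1; lra.
Qed.

Lemma residual_support_attained p k :
  (forall i, p.1 ord0 i + p.2 ord0 i <= p.1 ord0 k + p.2 ord0 k) ->
  exists2 t, admissible t.2 &
    dotp p (residual_point t) = residual_support p (p.1 ord0 k + p.2 ord0 k).
Proof.
move=> pM; set M := p.1 ord0 k + p.2 ord0 k in pM *.
(* Setting the bit exactly when [a > 0] makes [2 b a = |a| + a]. Opposite entries are never both
   set, because their two sums add up to two diagonal sums. *)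
exists (k, \matrix_(i, j) (M < p.1 ord0 i + p.2 ord0 j)) => [i j|].
  rewrite !mxE; apply/negP => /andP[].
  by have := pM i; have := pM j; lra.
rewrite residual_point_dot -/M; set b := \matrix_(i, j) _.
have : \sum_i \sum_j (b i j)%:R * 2 * (p.1 ord0 i + p.2 ord0 j - M) =
    cross p M + (n%:R * coord_sum p - n%:R ^+ 2 * M).
  rewrite -cross_sum /cross -big_split; apply: eq_bigr => i _.
  rewrite -big_split; apply: eq_bigr => j _ /=; rewrite mxE.
  case: ltP => Ma; first by rewrite gtr0_norm ?subr_gt0//=; ring.
  by rewrite ler0_norm ?subr_le0//=; ring.
have -> : \sum_i \sum_j (b i j)%:R * 2 * (p.1 ord0 i + p.2 ord0 j - M) =
    2 * (\sum_i \sum_j (b i j)%:R * (p.1 ord0 i + p.2 ord0 j))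
    - 2 * M * \sum_i \sum_j (b i j)%:R.
  rewrite !mulr_sumr -sumrB; apply: eq_bigr => i _.
  rewrite !mulr_sumr -sumrB; apply: eq_bigr => j _; ring.
rewrite /residual_support /residual_coeff -[n.+1%:R]natr1; lra.
Qed.

End SupportFunctions.

(** * Bar words of bipermutations *)

Section BarWord.
Variables (n : nat) (k : 'I_n).
Implicit Types (i : 'I_n) (s B : seq 'I_n) (c : bool).

Lemma bar_word_count_k s B c :
  count_mem (k, c) (bar_word_rec k s B) = count_mem k B.
Proof.
elim: B s => //= b B IH s; rewrite count_cat IH; congr (_ + _)%N.
by case: (eqVneq b k) => [_|/negPf bk]; rewrite /= !xpair_eqE ?eqxx ?bk//=;
  case: (c) => //=.
Qed.

Lemma bar_word_count_both s B i : i != k ->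
  (count_mem (i, false) (bar_word_rec k s B) +
   count_mem (i, true) (bar_word_rec k s B))%N = count_mem i B.
Proof.
move=> /negPf ik; elim: B s => //= b B IH s; rewrite !count_cat addnACA IH.
congr (_ + _)%N; case: (eqVneq b k) => [->|bk] /=.
  by rewrite !xpair_eqE eq_sym ik.
by rewrite !xpair_eqE; case: (b == i); case: (b \in s).
Qed.

Lemma bar_word_count_false s B i : i != k ->
  count_mem (i, false) (bar_word_rec k s B) = (i \in B) && (i \notin s).
Proof.
move=> ik; elim: B s => //= b B IH s; rewrite count_cat IH !inE.
case: (eqVneq b k) => [->|bk] /=.
  by rewrite !xpair_eqE eq_sym (negPf ik).
rewrite !xpair_eqE; case: (eqVneq b i) => [->|] /=.
  by rewrite andbF; case: (i \in s).
by [].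
Qed.

Lemma bar_word_index s B i : i \notin s ->
  (index (i, false) (bar_word_rec k s B)
     <= index (i, true) (bar_word_rec k s B))%N.
Proof.
elim: B s => //= b B IH s si; case: (eqVneq b k) => [->|bk] /=.
  rewrite !xpair_eqE /= !andbF !andbT; case: (eqVneq k i) => // ki.
  by rewrite !ltnS IH// inE negb_or eq_sym ki.
rewrite !xpair_eqE; case: (eqVneq b i) => [->|bi] /=.
  by rewrite (negPf si).
by rewrite ltnS IH// inE negb_or eq_sym bi.
Qed.

Lemma bar_word_perm (B : (2 * n).-1.-tuple 'I_n) : bipermutation k B ->
  perm_eq (bar_word k B) (enum {: 'I_n * bool}).
Proof.
move=> [Bk Bi]; apply/allP => -[i c] _ /=.
rewrite [X in _ == X]count_uniq_mem ?enum_uniq// mem_enum inE /bar_word.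
have [->|ik] := eqVneq i k; first by rewrite bar_word_count_k Bk.
have iB : i \in tval B by rewrite -has_pred1 has_count Bi.
have := bar_word_count_both [::] B ik.
rewrite Bi// bar_word_count_false// iB /=.
by case: c => H; [apply/eqP; lia|rewrite bar_word_count_false// iB].
Qed.

Definition unfold_letter (a : 'I_n * bool) : seq ('I_n * bool) :=
  if a.1 == k then [:: (k, false); (k, true)] else [:: a].

(** The route from a chosen order of letters to a bipermutation: dropping the bars of [L] gives the
    sequence, and its bar word is [L] with [k] doubled. *)
Lemma bar_word_rec_map s (L : seq ('I_n * bool)) :
    (forall L1 a L2, L = L1 ++ a :: L2 -> a.1 != k ->
       a.2 = (a.1 \in map fst L1 ++ s)) ->
  bar_word_rec k s (map fst L) = flatten (map unfold_letter L).
Proof.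
elim: L s => //= a L IH s HL; congr (_ ++ _).
  rewrite /unfold_letter; case: eqVneq => // ak; congr [:: _].
  by rewrite -(HL [::] a L)// -surjective_pairing.
apply: IH => L1 b L2 LE bk; rewrite (HL (a :: L1) b L2) ?LE//=.
by rewrite !(inE, mem_cat) orbCA.
Qed.

Lemma unfold_letter_pairwise (R : realType) (z : 'I_n * bool -> R) L :
    pairwise (relpre z <=%R) L -> z (k, false) = z (k, true) ->
    (forall a, a \in L -> a.1 = k -> a = (k, false)) ->
  pairwise (relpre z <=%R) (flatten (map unfold_letter L)).
Proof.
move=> + zk; elim: L => //= a L IH /andP[aL pL] Lk.
have zE b d : b \in a :: L -> d \in unfold_letter b -> z d = z b.
  rewrite /unfold_letter => bL; case: eqP => [bk|_].
    by rewrite (Lk b)// !inE => /orP[]/eqP->.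
  by rewrite inE => /eqP->.
rewrite pairwise_cat IH ?andbT//; last first.
  by move=> b bL; apply: Lk; rewrite inE bL orbT.
apply/andP; split; last first.
  by rewrite /unfold_letter; case: ifP => //= _; rewrite zk lexx.
apply/allrelP => d e dE /flatten_mapP[b bL eE].
rewrite /= (zE a d) ?mem_head// (zE b e)// ?inE ?bL ?orbT//.
by move/allP: aL; exact.
Qed.

End BarWord.

(** * Letter values as pairwise precedence signs *)

Section WordValues.
Variables (R : realType) (L : finType) (W : seq L).
Hypothesis WL : perm_eq W (enum L).

Lemma word_uniq : uniq W. Proof. by rewrite (perm_uniq WL) enum_uniq. Qed.

Lemma word_mem a : a \in W. Proof. by rewrite (perm_mem WL) mem_enum. Qed.

Lemma index_sum a : (\sum_b (index b W < index a W) = index a W)%N.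
Proof.
rewrite -big_enum /= -(perm_big _ WL) /=.
have -> : (\sum_(b <- W) (index b W < index a W) =
           \sum_(j <- map (index^~ W) W) (j < index a W))%N by rewrite big_map.
have -> : map (index^~ W) W = iota 0 (size W).
  apply: (@eq_from_nth _ 0%N); first by rewrite size_map size_iota.
  move=> j; rewrite size_map => jW.
  by rewrite (nth_map a)// nth_iota// index_uniq// word_uniq.
have : (index a W <= size W)%N by rewrite index_size.
move: (index a W) (size W) => i N iN.
rewrite -(subnKC iN) iotaD add0n big_cat /=.
rewrite [X in (_ + X)%N]big_seq [X in (_ + X)%N]big1 => [|j].
  rewrite addn0 big_seq (eq_bigr (fun=> 1%N)) => [|j].
    by rewrite -big_seq sum1_size size_iota.
  by rewrite mem_iota => /andP[_ ->].
by rewrite mem_iota => /andP[ij _]; rewrite ltnNge ij.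
Qed.

Definition precedence a b : R :=
  (index b W < index a W)%:R - (index a W < index b W)%:R.

Lemma precedenceN a b : precedence a b = - precedence b a.
Proof. by rewrite opprB. Qed.

(** The value of a letter is the number of letters before it minus the number after it. *)
Lemma word_valueE a :
  (2 * index a W)%:R - #|L|%:R + 1 = \sum_b precedence a b.
Proof.
have tri : (\sum_b ((index b W < index a W) + (index a W < index b W)
                    + (b == a)) = #|L|)%N.
  rewrite -sum1_card; apply: eq_bigr => b _.
  have : (index b W == index a W) = (b == a).
    apply/eqP/eqP => [|->//]; apply: (@index_inj _ a W) => //; exact: word_mem.
  by case: ltngtP => // _ <-.
rewrite !big_split /= index_sum in tri.
have da : (\sum_b (b == a) = 1)%N.
  by rewrite (bigD1 a)//= eqxx big1// => b /negPf->.
rewrite sumrB -!natr_sum index_sum -tri da.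
by rewrite natrM !natrD; ring.
Qed.

Lemma word_value_sum0 : \sum_a ((2 * index a W)%:R - #|L|%:R + 1 : R) = 0.
Proof.
have := @sum_antisym R L (fun=> 1) precedence precedenceN.
under eq_bigr do rewrite mul1r -word_valueE.
move=> ->; rewrite big1 ?mul0r// => a _.
by rewrite big1// => b _; rewrite subrr mul0r.
Qed.

(** The rearrangement inequality, pair by pair: a difference times a precedence sign is at most its
    absolute value, with equality when [W] is sorted by [z]. *)
Lemma word_dot_le (z : L -> R) :
  \sum_a z a * ((2 * index a W)%:R - #|L|%:R + 1) <= dif z / 2.
Proof.
under eq_bigr do rewrite word_valueE.
rewrite (sum_antisym z precedenceN) ler_wpM2r//.
apply: ler_sum => a _; apply: ler_sum => b _; rewrite /precedence.
have := ler_norm (z a - z b); have := ler_norm (- (z a - z b)); rewrite normrN.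
by case: ltngtP => _ /=; lra.
Qed.

Lemma word_dot_eq (z : L -> R) : sorted (relpre z <=%R) W ->
  \sum_a z a * ((2 * index a W)%:R - #|L|%:R + 1) = dif z / 2.
Proof.
move=> zs; have zm a b : (index a W < index b W)%N -> z a <= z b.
  have tr : transitive (relpre z <=%R) by move=> ? ? ?; exact: le_trans.
  by apply: (sorted_ltn_index tr zs); exact: word_mem.
under eq_bigr do rewrite word_valueE.
rewrite (sum_antisym z precedenceN); congr (_ / _).
apply: eq_bigr => a _; apply: eq_bigr => b _; rewrite /precedence.
case: ltngtP => [/zm ba|/zm ab|ab] /=.
- by rewrite ger0_norm ?subr_ge0//; ring.
- by rewrite ler0_norm ?subr_le0//; ring.
- have -> : a = b by apply: (@index_inj _ a W) => //; exact: word_mem.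
  by rewrite subrr mul0r normr0.
Qed.

End WordValues.

(** * Support function of the bipermutahedron *)

Section BipermutahedronSupport.
Variables (R : realType) (n : nat).
Local Notation V := ('rV[R]_n * 'rV[R]_n)%type.
Implicit Types (p : V) (M : R) (k : 'I_n) (B : (2 * n).-1.-tuple 'I_n).

(* In these [2n] coordinates the support function of the bipermutahedron is
   that of a permutohedron. *)
Definition letter_coord p M (a : 'I_n * bool) : R :=
  if a.2 then - p.2 ord0 a.1 else p.1 ord0 a.1 - M.

Lemma sum_letters (F : 'I_n * bool -> R) :
  \sum_a F a = \sum_i (F (i, false) + F (i, true)).
Proof.
rewrite (eq_bigr (fun a => F (a.1, a.2))) => [|[]//].
rewrite -(pair_bigA _ (fun i c => F (i, c))) /=.
by apply: eq_bigr => i _; rewrite big_bool addrC.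
Qed.

(** Pairs of letters of the same kind give the two [dif] terms; mixed pairs give every term of
    [cross] twice. *)
Lemma dif_letter_coord p M : dif (letter_coord p M) / 2 = biperm_support p M.
Proof.
rewrite /dif sum_letters; under eq_bigr do rewrite !sum_letters -big_split /=.
have -> : \sum_i \sum_j
    (`|letter_coord p M (i, false) - letter_coord p M (j, false)| +
     `|letter_coord p M (i, false) - letter_coord p M (j, true)| +
     (`|letter_coord p M (i, true) - letter_coord p M (j, false)| +
      `|letter_coord p M (i, true) - letter_coord p M (j, true)|)) =
   \sum_i \sum_j (`|p.1 ord0 i - p.1 ord0 j| + `|p.2 ord0 i - p.2 ord0 j|
     + (`|p.1 ord0 i + p.2 ord0 j - M| + `|p.1 ord0 j + p.2 ord0 i - M|)).
  apply: eq_bigr => i _; apply: eq_bigr => j _; rewrite /letter_coord /=.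
  have -> : p.1 ord0 i - M - (p.1 ord0 j - M) = p.1 ord0 i - p.1 ord0 j by ring.
  have -> : p.1 ord0 i - M - - p.2 ord0 j = p.1 ord0 i + p.2 ord0 j - M by ring.
  have -> : - p.2 ord0 i - (p.1 ord0 j - M) =
            - (p.1 ord0 j + p.2 ord0 i - M) by ring.
  have -> : - p.2 ord0 i - - p.2 ord0 j = - (p.2 ord0 i - p.2 ord0 j) by ring.
  by rewrite !normrN; ring.
under eq_bigr do rewrite !big_split /=.
rewrite !big_split /= [X in _ + (_ + X)]exchange_big.
by rewrite /biperm_support /dif /cross; field.
Qed.

(** Shifting the unbarred coordinates by [M] costs [M] times the sum [s] of the unbarred values,
    while the correction [- s (e_k + f_k)] of the vertex costs [s] times the diagonal sum at [k]. *)
Lemma biperm_vertex_dot p M k B :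
  dotp p (biperm_vertex R k B) =
  \sum_a letter_coord p M a * letter_value R k B a
  + (\sum_i letter_value R k B (i, false)) * (M - (p.1 ord0 k + p.2 ord0 k)).
Proof.
rewrite /biperm_vertex /biperm_u /=; set s := \sum_i _.
have -> : s = \sum_i letter_value R k B (i, false).
  by apply: eq_bigr => i _; rewrite mxE.
rewrite {}/s; set s := \sum_i _.
have expand (z f : 'I_n -> R) : \sum_i z i * (f i - s * (i == k)%:R) =
    \sum_i z i * f i - s * z k.
  rewrite -[z k](sum_delta_dot k) mulr_sumr -sumrB.
  by apply: eq_bigr => i _; ring.
rewrite /dotp /=; under eq_bigr do rewrite !mxE eqxx /=.
under [X in _ + X]eq_bigr do rewrite !mxE eqxx /=.
rewrite !expand sum_letters /letter_coord /=.
have -> : \sum_i ((p.1 ord0 i - M) * letter_value R k B (i, false) +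
                - p.2 ord0 i * letter_value R k B (i, true)) =
    \sum_i p.1 ord0 i * letter_value R k B (i, false) - M * s
    + \sum_i p.2 ord0 i * - letter_value R k B (i, true).
  rewrite /s mulr_sumr -sumrB -big_split; apply: eq_bigr => i _ /=; ring.
by ring.
Qed.

Lemma letter_valueE k B a : letter_value R k B a =
  (2 * index a (bar_word k B))%:R - #|{: 'I_n * bool}|%:R + 1.
Proof. by rewrite card_prod card_ord card_bool [(n * 2)%N]mulnC. Qed.

(** All letter values sum to zero, and each unbarred letter precedes its barred copy. *)
Lemma first_letters_le0 k B : bipermutation k B ->
  \sum_i letter_value R k B (i, false) <= 0.
Proof.
move=> /bar_word_perm WL; have := word_value_sum0 R WL.
under eq_bigr do rewrite -letter_valueE.
rewrite sum_letters big_split /=.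
have : \sum_i letter_value R k B (i, false) <=
    \sum_i letter_value R k B (i, true).
  apply: ler_sum => i _; rewrite /letter_value lerD2r lerD2r ler_nat.
  by rewrite leq_mul2l /=; apply: bar_word_index.
by lra.
Qed.

Lemma biperm_support_ge p M k B : bipermutation k B ->
    (forall i, p.1 ord0 i + p.2 ord0 i <= M) ->
  dotp p (biperm_vertex R k B) <= biperm_support p M.
Proof.
move=> kB pM; rewrite (biperm_vertex_dot p M) -dif_letter_coord.
have := word_dot_le (bar_word_perm kB) (letter_coord p M).
under eq_bigr do rewrite -letter_valueE.
have : (\sum_i letter_value R k B (i, false))
    * (M - (p.1 ord0 k + p.2 ord0 k)) <= 0.
  by rewrite mulr_le0_ge0 ?first_letters_le0// subr_ge0.
by lra.
Qed.

(* Sort all letters but the barred [k] by their coordinate, unbarred first in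
   case of ties. *)
Lemma biperm_support_attained p k :
    (forall i, p.1 ord0 i + p.2 ord0 i <= p.1 ord0 k + p.2 ord0 k) ->
  exists2 B, bipermutation k B & dotp p (biperm_vertex R k B) =
                                 biperm_support p (p.1 ord0 k + p.2 ord0 k).
Proof.
set M := p.1 ord0 k + p.2 ord0 k => pM.
pose z := letter_coord p M.
pose le (a b : 'I_n * bool) := (z a < z b) || ((z a == z b) && (a.2 ==> b.2)).
have le_tr : transitive le.
  move=> b a c; rewrite /le; case: (ltgtP (z a) (z b)) => //= [ab _|->].
    case: (ltgtP (z b) (z c)) => //= [bc _|<- _]; last by rewrite ab.
    by rewrite (lt_trans ab bc).
  case: (ltgtP (z b) (z c)) => //= _.
  by case: a.2 => //=; case: b.2.
have le_tot : total le.
  move=> a b; rewrite /le; case: (ltgtP (z a) (z b)) => //= _.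
  by case: a.2; case: b.2.
have le_z a b : le a b -> z a <= z b.
  by rewrite /le => /orP[/ltW//|/andP[/eqP->]].
have zk : z (k, false) = z (k, true) by rewrite /z /letter_coord /M /=; ring.
have z_ft i : z (i, false) <= z (i, true).
  by rewrite /z /letter_coord /=; have := pM i; lra.
(* [unfold_letter] restores [(k, true)] right after [(k, false)]; by [zk] the two have equal
   coordinates, so the word stays sorted. *)
pose L := sort le [seq a <- enum {: 'I_n * bool} | a != (k, true)].
have L_mem a : (a \in L) = (a != (k, true)).
  by rewrite mem_sort mem_filter /= mem_enum andbT.
have L_uniq : uniq L by rewrite sort_uniq filter_uniq// enum_uniq.
have L_le : pairwise le L by rewrite -sorted_pairwise// sort_sorted.
have L_count i : count_mem i (map fst L) = (i != k).+1.
  rewrite count_map -size_filter.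
  have -> : (i != k).+1 = size (if i == k then [:: (i, false)]
                               else [:: (i, false); (i, true)]).
    by case: (i == k).
  apply/perm_size/uniq_perm; first by rewrite filter_uniq.
    by case: (i == k); rewrite //= inE xpair_eqE andbF.
  move=> [j c]; rewrite mem_filter L_mem /= xpair_eqE.
  have [->|ik] := eqVneq i k; rewrite !inE !xpair_eqE.
    by case: (j == k); case: c.
  by have [->|] := eqVneq j i; rewrite ?(negPf ik); case: c.
have size_L : size (map fst L) == (2 * n).-1.
  have := count_predC (pred1 (k, true)) (enum {: 'I_n * bool}).
  rewrite count_uniq_mem ?enum_uniq// mem_enum -cardE card_prod card_ord.
  rewrite card_bool mulnC add1n size_map size_sort size_filter => <-.
  by [].
pose B := Tuple size_L.
have kB : bipermutation k B.
  by split => [|i ik]; rewrite /B /= L_count ?eqxx// ik.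
have W_L : bar_word k B = flatten (map (unfold_letter k) L).
  apply: bar_word_rec_map => L1 [i c] L2 LE /= ik; rewrite cats0.
  (* Maximality of [M] and the tie rule put [(i, false)] before [(i, true)], so a bar marks exactly
     a repeated entry. *)
  have le_false : le (i, true) (i, false) = false.
    rewrite /le /= andbF orbF; apply/negbTE; rewrite -leNgt; exact: z_ft.
  move: L_uniq L_le (L_mem (i, false)).
  rewrite LE cat_uniq pairwise_cat xpair_eqE andbF /=.
  move=> /and3P[_ /norP[iL1 _] _] /and3P[/allrelP le12 _ /andP[/allP le2 _]].
  case: c iL1 le12 le2 LE => iL1 le12 le2 LE.
    rewrite mem_cat inE => /or3P[i1|/eqP//|/le2]; last by rewrite le_false.
    by apply/esym/mapP; exists (i, false).
  move=> _; apply/esym/negbTE/mapP => -[[j c] jL1 /= ij].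
  rewrite -ij in jL1; case: c jL1 => jL1; last by rewrite jL1 in iL1.
  by have := le12 _ _ jL1 (mem_head _ _); rewrite le_false.
exists B => //; rewrite (biperm_vertex_dot p M) subrr mulr0 addr0.
under eq_bigr do rewrite letter_valueE.
rewrite (word_dot_eq (bar_word_perm kB)) ?dif_letter_coord// W_L.
apply/pairwise_sorted/unfold_letter_pairwise => //.
  by apply: sub_pairwise L_le => a b /le_z.
by move=> [i c]; rewrite L_mem xpair_eqE => + /= ik; rewrite ik eqxx; case: c.
Qed.

End BipermutahedronSupport.

(** * The decomposition of the bipermutahedron and the bound on the quotient *)

Section Quotient.
Variables (R : realType) (n : nat).
Local Notation V := ('rV[R]_n * 'rV[R]_n)%type.
Local Notation H := (harmonic_polytope R n).
Local Notation Pi := (bipermutahedron R n).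
Hypothesis n2 : (2 <= n)%N.
Implicit Types (p : V) (M : R) (k : 'I_n).

Definition maximizes p k :=
  forall i, p.1 ord0 i + p.2 ord0 i <= p.1 ord0 k + p.2 ord0 k.

Lemma maximizer_exists p : exists k, maximizes p k.
Proof.
have n0 : (0 < n)%N by apply: leq_trans n2.
case: (@Order.TotalTheory.arg_maxP _ _ _ (Ordinal n0) predT
  (fun i => p.1 ord0 i + p.2 ord0 i) isT) => k _ kM.
by exists k => i; exact: kM.
Qed.

Lemma harmonic_convex : convex_set (H : set (convex_lmodType V)).
Proof.
apply/convex_setE => x y t t0 t1 [x1 x2 xST] [y1 y2 yST].
have lin (f g : 'rV[R]_n) (S : {set 'I_n}) :
    \sum_(i in S) (t *: f + (1 - t) *: g) ord0 i =
    t * \sum_(i in S) f ord0 i + (1 - t) * \sum_(i in S) g ord0 i.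
  rewrite !mulr_sumr -big_split; apply: eq_bigr => i _.
  by rewrite !mxE.
have linT (f g : 'rV[R]_n) :
    \sum_i (t *: f + (1 - t) *: g) ord0 i =
    t * \sum_i f ord0 i + (1 - t) * \sum_i g ord0 i.
  rewrite !mulr_sumr -big_split; apply: eq_bigr => i _.
  by rewrite !mxE.
split=> [||S T ST] /=.
- by rewrite linT x1 y1; ring.
- by rewrite linT x2 y2; ring.
rewrite !lin; have := ler_wpM2l t0 (xST S T ST).
have t1' : 0 <= 1 - t by rewrite subr_ge0.
by have := ler_wpM2l t1' (yST S T ST); lra.
Qed.

Definition biperm_vertices : set V :=
  [set v | exists k (B : (2 * n).-1.-tuple 'I_n),
     bipermutation k B /\ v = biperm_vertex R k B].

Lemma biperm_vertices_finite : finite_set biperm_vertices.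
Proof.
apply: (@sub_finite_set _ _ ((fun t : 'I_n * (2 * n).-1.-tuple 'I_n =>
  biperm_vertex R t.1 t.2) @` setT)).
  by move=> _ [k [B [_ ->]]]; exists (k, B).
exact: finite_image.
Qed.

Lemma biperm_dot_le p k v : maximizes p k -> Pi v ->
  dotp p v <= biperm_support p (p.1 ord0 k + p.2 ord0 k).
Proof.
move=> pk; apply: dotp_hull_le => _ [k' [B [kB ->]]].
exact: biperm_support_ge.
Qed.

Definition residual_points : set V :=
  @residual_point R n @` [set t | admissible t.2].

(** Each inclusion is by contradiction: in a separating direction [p], points attaining the support
    functions at a maximizer violate [biperm_support_split]. *)
Lemma bipermutahedron_decomposition :
  Pi = minkowski_sum (dilate 2 H) (convex_hull residual_points).
Proof.
have finr : finite_set residual_points by exact: finite_image.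
apply/seteqP; split.
  apply: convex_hull_min.
    apply: convex_setD; last exact: convex_hull_convex.
    exact/convex_setZ/harmonic_convex.
  (* Separation is from a finite set, so the harmonic points stand in for all of [H]. *)
  pose Z := [set 2 *: h + r | h in range (@harmonic_point R n)
                            & r in residual_points].
  have finZ : finite_set Z by apply: finite_image2 => //; exact: finite_image.
  have ZS : convex_hull Z `<=`
      minkowski_sum (dilate 2 H) (convex_hull residual_points).
    apply: convex_hull_min.
      apply: convex_setD; last exact: convex_hull_convex.
      exact/convex_setZ/harmonic_convex.
    move=> _ [_ [t _ <-] [r rX <-]].
    exists (2 *: harmonic_point R t).
      by exists (harmonic_point R t) => //; exact: harmonic_point_in.
    by exists r => //; exact: convex_hullW.
  move=> v vX; apply: ZS.
  apply: contrapT => /(convex_hull_separation finZ)[p pZ].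
  have [k pk] := maximizer_exists p.
  have [t tE] := harmonic_support_attained p k.
  have [t' at' t'E] := residual_support_attained pk.
  have /pZ : Z (2 *: harmonic_point R t + residual_point R t').
    by exists (harmonic_point R t) => //; exists (residual_point R t') => //;
      exists t'.
  rewrite linearD linearZ /= tE t'E -biperm_support_split ltNge.
  by rewrite (biperm_dot_le pk)//; exact: convex_hullW.
move=> _ [_ [h Hh <-] [r rS <-]].
apply: contrapT => /(convex_hull_separation biperm_vertices_finite)[p pX].
have [k pk] := maximizer_exists p.
have [B kB BE] := biperm_support_attained pk.
have /pX : biperm_vertices (biperm_vertex R k B) by exists k, B.
rewrite BE biperm_support_split linearD linearZ /= ltNge.
move/negP; apply; apply: lerD.
  by rewrite ler_wpM2l//; exact: harmonic_support_ge.
by apply: dotp_hull_le rS => _ [t at_ <-]; exact: residual_support_ge.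
Qed.

Lemma coord_sumE p : coord_sum p = dotp (const_mx 1, const_mx 1) p.
Proof.
by congr (_ + _); apply: eq_bigr => i _; rewrite mxE mul1r.
Qed.

Definition candidate l p k : R :=
  biperm_support p (p.1 ord0 k + p.2 ord0 k)
  - l * harmonic_support p (p.1 ord0 k + p.2 ord0 k).

(* If [Pi = l H + S] then [candidate l] is the support function of [S], hence
   midpoint convex. *)
Lemma candidate_convex l p0 p1 p2 k0 k1 k2 : 0 <= l ->
    is_minkowski_summand (dilate l H) Pi -> p1 + p2 = 2 *: p0 ->
    maximizes p0 k0 -> maximizes p1 k1 -> maximizes p2 k2 ->
  2 * candidate l p0 k0 <= candidate l p1 k1 + candidate l p2 k2.
Proof.
move=> l0 [S _ PS] pE p0k p1k p2k.
(* One point suffices: the part [s] in [S] of a vertex of [Pi] optimal for [p0] pairs to at least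
   the candidate at [p0] and to at most the candidate in any direction. *)
have [B kB BE] := biperm_support_attained p0k.
have : Pi (biperm_vertex R k0 B) by apply: convex_hullW; exists k0, B.
rewrite PS => -[_ [h Hh <-] [s Ss hs]].
have low : candidate l p0 k0 <= dotp p0 s.
  rewrite /candidate -BE -hs linearD linearZ /= /GRing.scale /=.
  have := ler_wpM2l l0 (harmonic_support_ge Hh p0k); lra.
have up p k : maximizes p k -> dotp p s <= candidate l p k.
  move=> pk; have [t tE] := harmonic_support_attained p k.
  have : Pi (l *: harmonic_point R t + s).
    rewrite PS; exists (l *: harmonic_point R t); last by exists s.
    by exists (harmonic_point R t) => //; exact: harmonic_point_in.
  move/(biperm_dot_le pk); rewrite linearD linearZ /= tE /candidate.
  by rewrite /GRing.scale /=; lra.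
have : dotp p1 s + dotp p2 s = 2 * dotp p0 s.
  by rewrite ![dotp _ s]dotpC -linearD pE linearZ.
have := up _ _ p1k; have := up _ _ p2k; lra.
Qed.

Lemma quotient_le_large l : (2 < n)%N -> 0 <= l ->
  is_minkowski_summand (dilate l H) Pi -> l <= 2.
Proof.
move=> n3 l0 lH.
pose k : 'I_n := Ordinal (ltnW (ltnW n3)).
pose i : 'I_n := Ordinal (ltnW n3).
pose j : 'I_n := Ordinal n3.
(* As [t] passes through 0 the coordinate of [i] crosses that of [j], while [k] stays the maximizer
   with diagonal sum 2. *)
pose f (t : R) (a : 'I_n) : R := (a == k)%:R + t * (a == i)%:R.
pose P t : V := (\row_a f t a, \row_a (a == k)%:R).
have P1 t a : (P t).1 ord0 a = f t a by rewrite mxE.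
have P2 t a : (P t).2 ord0 a = (a == k)%:R by rewrite mxE.
have le2 t a b : t <= 1 -> (P t).1 ord0 a + (P t).2 ord0 b <= 2.
  move=> t1; rewrite P1 P2 /f; have [->|_] := eqVneq a k.
    by case: (b == k); rewrite /= mulr0; lra.
  by case: (a == i); case: (b == k); rewrite /=; lra.
have Pk t : (P t).1 ord0 k + (P t).2 ord0 k = 2.
  by rewrite P1 P2 /f eqxx /=; lra.
have maxP t : t <= 1 -> maximizes (P t) k by move=> t1 a; rewrite Pk le2.
(* No sum [u_a + w_b] exceeds 2, so all absolute values open with the same sign and [cross] is
   affine in [t]. Only [dif (f t)] bends, with coefficient [(2 - l) / 4]. *)
have crossE t : t <= 1 ->
    cross (P t) 2 = n%:R ^+ 2 * 2 - n%:R * coord_sum (P t).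
  move=> t1; rewrite -[RHS]opprB -cross_sum /cross -sumrN.
  apply: eq_bigr => a _; rewrite -sumrN; apply: eq_bigr => b _.
  by rewrite ler0_norm// subr_le0 le2.
have candE t : t <= 1 -> candidate l (P t) k =
    (2 - l) / 4 * dif (f t) + (2 - l) / 4 * dif (fun a => (a == k)%:R)
    + (n%:R ^+ 2 * 2 - l * 2) - (n%:R + l * (n.+1%:R / 2)) * coord_sum (P t).
  move=> t1; have d1 : dif ((P t).1 ord0) = dif (f t).
    by apply: eq_bigr => a _; apply: eq_bigr => b _; rewrite !P1.
  have d2 : dif ((P t).2 ord0) = dif (fun a => (a == k)%:R).
    by apply: eq_bigr => a _; apply: eq_bigr => b _; rewrite !P2.
  rewrite /candidate Pk /biperm_support /harmonic_support crossE// d1 d2.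
  by field.
have PE : P 1 + P (-1) = 2 *: P 0.
  by congr pair; apply/rowP => a; rewrite !mxE /f; ring.
have cE : coord_sum (P 1) + coord_sum (P (-1)) = 2 * coord_sum (P 0).
  by rewrite !coord_sumE -linearD PE linearZ.
have dE : 0 < dif (f 1) + dif (f (-1)) - 2 * dif (f 0).
  have fE a : f 1 a + f (-1) a = 2 * f 0 a by rewrite /f; ring.
  have g0 a b : 0 <= `|f 1 a - f 1 b| + `|f (-1) a - f (-1) b|
                     - 2 * `|f 0 a - f 0 b|.
    rewrite subr_ge0 -[X in X * _](normr_nat R 2) -normrM.
    apply: le_trans (ler_normD _ _).
    by rewrite le_eqVlt; apply/orP/or_introl/eqP; congr `|_|;
      rewrite mulrBr -!fE; ring.
  (* Every pair has a nonnegative second difference, and the pair [(i, j)] contributes 1 + 1 - 0. *)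
  have -> : dif (f 1) + dif (f (-1)) - 2 * dif (f 0) =
      \sum_a \sum_b (`|f 1 a - f 1 b| + `|f (-1) a - f (-1) b|
                     - 2 * `|f 0 a - f 0 b|).
    rewrite /dif mulr_sumr -big_split -sumrB; apply: eq_bigr => a _ /=.
    by rewrite mulr_sumr -big_split -sumrB.
  rewrite (bigD1 i)//= ltr_wpDr//.
    by apply: sumr_ge0 => a _; exact: sumr_ge0.
  rewrite (bigD1 j)//= ltr_wpDr//; first exact: sumr_ge0.
  rewrite /f /= !mulr0 !mulr1 !addr0 !add0r !subr0 oppr0 normr1 normrN1.
  by rewrite normr0; lra.
have m1 : -1 <= 1 :> R by lra.
have :=
  candidate_convex l0 lH PE (maxP 0 ler01) (maxP 1 (lexx 1)) (maxP (-1) m1).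
rewrite !candE ?ler01 ?lexx// => conv.
rewrite leNgt; apply/negP => l2.
have : (2 - l) * (dif (f 1) + dif (f (-1)) - 2 * dif (f 0)) < 0.
  by rewrite nmulr_rlt0 // subr_lt0.
have := congr1 ( *%R (n%:R + l * (n.+1%:R / 2))) cE; rewrite mulrDr.
by move: conv; lra.
Qed.

End Quotient.

(** With two indices the wall [u_1 = u_2] also bends [cross]. Instead the diagonal sums [x - 1] and
    [0] of [P x] meet at [x = 1]; over [x = 0, 1, 2] the second difference is 2 for the
    bipermutahedron and 1 for the harmonic polytope. *)
Lemma quotient_le_two (R : realType) (l : R) : 0 <= l ->
  is_minkowski_summand (dilate l (harmonic_polytope R 2))
    (bipermutahedron R 2) ->
  l <= 2.
Proof.
move=> l0 lH.
pose P (x : R) : 'rV[R]_2 * 'rV[R]_2 :=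
  (\row_a (if a == ord0 then x else -1), \row_a (if a == ord0 then -1 else 1)).
have PE : P 2 + P 0 = 2 *: P 1.
  by congr pair; apply/rowP => a; rewrite !mxE; case: ifP => _; ring.
have max0 x : 1 <= x -> maximizes (P x) ord0.
  by move=> x1 a; rewrite !mxE eqxx; case: ifP => _; lra.
have max1 : maximizes (P 0) ord_max.
  by move=> a; rewrite !mxE /=; case: ifP => _; lra.
have := candidate_convex l0 lH PE (max0 1 (lexx _)) (max0 2 (ler1n _ 2)) max1.
rewrite /candidate /biperm_support /harmonic_support /cross /dif /coord_sum.
rewrite !big_ord_recl !big_ord0 !mxE /=.
repeat match goal with |- context[`|?x|] => first
  [ have -> : `|x| = x by apply: ger0_norm; lra
  | have -> : `|x| = - x by apply: ler0_norm; lra] end.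
lra.
Qed.

Theorem theorem9p4 (R : realType) (n : nat) (hn : (2 <= n)%N) :
  is_minkowski_quotient (bipermutahedron R n) (harmonic_polytope R n) 2.
Proof.
split.
  split; first exact: ler0n.
  exists (convex_hull (@residual_points R n)).
    by exists (@residual_points R n) => //; exact: finite_image.
  exact: bipermutahedron_decomposition.
move=> l [l0 lH]; have := hn; rewrite leq_eqVlt => /orP[/eqP n2|n3].
  by subst n; exact: quotient_le_two.
exact: quotient_le_large n3 l0 lH.
Qed.
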